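(* Let $(\mathcal{A},\prec,\succ,\cdot,\alpha)$ be a Hom-post-alternative superalgebra. Define a new bilinear operation by $$x\bullet y=x\prec y+x\succ y+x\cdot y,\qquad x,y\in\mathcal{H}(\mathcal{A}).$$ Then $(\mathcal{A},\bullet,\alpha)$ is a Hom-alternative superalgebra.
   Context: $\mathbb{K}$ is an algebraically closed field of characteristic $0$; all vector spaces are finite-dimensional over $\mathbb{K}$. For a $\mathbb{Z}_2$-graded vector space $\mathcal{A}=\mathcal{A}_0\oplus\mathcal{A}_1$, $\mathcal{H}(\mathcal{A})$ denotes the set of homogeneous elements and $|x|$ the degree of $x\in\mathcal{H}(\mathcal{A})$. A linear or bilinear map is even if it preserves the grading. A Hom-superalgebra $(\mathcal{A},\mu,\alpha)$ is a $\mathbb{Z}_2$-graded vector space with an even bilinear map $\mu:\mathcal{A}\times\mathcal{A}\to\mathcal{A}$ and an even linear map $\alpha:\mathcal{A}\to\mathcal{A}$. All Hom-superalgebras are assumed multiplicative: $\alpha(\mu(x,y))=\mu(\alpha(x),\alpha(y))$ (for structures with several operations, this holds for each operation). The Hom-associator is $as_{\mathcal{A}}(x,y,z)=\mu(\mu(x,y),\alpha(z))-\mu(\alpha(x),\mu(y,z))$. A Hom-superalgebra is Hom-alternative if for all $x,y,z\in\mathcal{H}(\mathcal{A})$: $as_{\mathcal{A}}(x,y,z)+(-1)^{|x||y|}as_{\mathcal{A}}(y,x,z)=0$ and $as_{\mathcal{A}}(x,y,z)+(-1)^{|y||z|}as_{\mathcal{A}}(x,z,y)=0$. A Hom-post-alternative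 superalgebra is a tuple $(\mathcal{A},\prec,\succ,\cdot,\alpha)$ where $\mathcal{A}$ is a $\mathbb{Z}_2$-graded vector space, $\prec,\succ,\cdot$ are even bilinear maps $\mathcal{A}\times\mathcal{A}\to\mathcal{A}$ and $\alpha$ is an even linear map such that, writing $x\bullet y=x\succ y+x\prec y+x\cdot y$, for all $x,y,z\in\mathcal{H}(\mathcal{A})$: (1) $(x\cdot y)\cdot\alpha(z)-\alpha(x)\cdot(y\cdot z)+(-1)^{|x||y|}(y\cdot x)\cdot\alpha(z)-(-1)^{|x||y|}\alpha(y)\cdot(x\cdot z)=0$; (2) $(x\cdot y)\cdot\alpha(z)-\alpha(x)\cdot(y\cdot z)+(-1)^{|y||z|}(x\cdot z)\cdot\alpha(y)-(-1)^{|y||z|}\alpha(x)\cdot(z\cdot y)=0$; (3) $(x\cdot y)\prec\alpha(z)-\alpha(x)\cdot(y\prec z)+(-1)^{|x||y|}(y\cdot x)\prec\alpha(z)-(-1)^{|x||y|}\alpha(y)\cdot(x\prec z)=0$; (4) $(x\succ y)\cdot\alpha(z)-\alpha(x)\succ(y\cdot z)+(-1)^{|y||z|}(x\succ z)\cdot\alpha(y)-(-1)^{|y||z|}\alpha(x)\succ(z\cdot y)=0$; (5) $(y\succ x)\cdot\alpha(z)-\alpha(y)\succ(x\cdot z)+(-1)^{|x||y|}(x\prec y)\cdot\alpha(z)-(-1)^{|x||y|}\alpha(x)\cdot(y\succ z)=0$; (6) $(z\prec x)\cdot\alpha(y)-\alpha(z)\cdot(x\succ y)+(-1)^{|x||y|}(z\cdot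 y)\prec\alpha(x)-(-1)^{|x||y|}\alpha(z)\cdot(y\prec x)=0$; (7) $(x\succ y)\prec\alpha(z)-\alpha(x)\succ(y\prec z)+(-1)^{|x||y|}(y\prec x)\prec\alpha(z)-(-1)^{|x||y|}\alpha(y)\prec(x\bullet z)=0$; (8) $(x\succ y)\prec\alpha(z)-\alpha(x)\succ(y\prec z)+(-1)^{|y||z|}(x\bullet z)\succ\alpha(y)-(-1)^{|y||z|}\alpha(x)\succ(z\succ y)=0$; (9) $(x\bullet y)\succ\alpha(z)-\alpha(x)\succ(y\succ z)+(-1)^{|x||y|}(y\bullet x)\succ\alpha(z)-(-1)^{|x||y|}\alpha(y)\succ(x\succ z)=0$; (10) $(z\prec x)\prec\alpha(y)-\alpha(z)\prec(x\bullet y)+(-1)^{|x||y|}(z\prec y)\prec\alpha(x)-(-1)^{|x||y|}\alpha(z)\prec(y\bullet x)=0$. *)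

(* Defs.v *)
From HB Require Import structures.
From mathcomp Require Import all_boot all_order all_algebra.
Set Implicit Arguments.
Unset Strict Implicit.
Unset Printing Implicit Defensive.
Import GRing.Theory.
Local Open Scope ring_scope.

Section Superalgebra.

Variables (K : fieldType) (A : vectType K).

(* A degree is an element of 'Z_2, and gr i is the subspace of elements of
   degree i.  Conditions "for all homogeneous x" are stated for all degrees i
   and all x \in gr i; the vector 0 belongs to both components. *)
Definition is_grading (gr : 'Z_2 -> {vspace A}) : Prop :=
  directv (\sum_(i : 'Z_2) gr i) /\ (\sum_(i : 'Z_2) gr i)%VS = fullv.

Definition even_map (gr : 'Z_2 -> {vspace A}) (f : A -> A) : Prop :=
  forall (i : 'Z_2) (x : A), x \in gr i -> f x \in gr i.

Definition even_map2 (gr : 'Z_2 -> {vspace A}) (mu : A -> A -> A) : Prop :=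
  forall (i j : 'Z_2) (x y : A),
    x \in gr i -> y \in gr j -> mu x y \in gr (i + j).

(* The Koszul sign (-1)^{|x||y|}; the exponent is the product of the
   representatives 0 or 1 of the degrees. *)
Definition ksign (i j : 'Z_2) : K := (-1) ^+ (i * j)%N.

Record is_hom_superalgebra (gr : 'Z_2 -> {vspace A})
    (mu : A -> A -> A) (alpha : A -> A) : Prop := {
  hsa_grading : is_grading gr;
  hsa_bilinear : bilinear_for *:%R *:%R mu;
  hsa_even_mul : even_map2 gr mu;
  hsa_linear : linear alpha;
  hsa_even_twist : even_map gr alpha;
  hsa_multiplicative : forall x y : A, alpha (mu x y) = mu (alpha x) (alpha y)
}.

Definition hom_associator (mu : A -> A -> A) (alpha : A -> A) (x y z : A) : A :=
  mu (mu x y) (alpha z) - mu (alpha x) (mu y z).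

Record is_hom_alternative (gr : 'Z_2 -> {vspace A})
    (mu : A -> A -> A) (alpha : A -> A) : Prop := {
  halt_hom_superalgebra : is_hom_superalgebra gr mu alpha;
  halt_left : forall (i j k : 'Z_2) (x y z : A),
    x \in gr i -> y \in gr j -> z \in gr k ->
    hom_associator mu alpha x y z
      + ksign i j *: hom_associator mu alpha y x z = 0;
  halt_right : forall (i j k : 'Z_2) (x y z : A),
    x \in gr i -> y \in gr j -> z \in gr k ->
    hom_associator mu alpha x y z
      + ksign j k *: hom_associator mu alpha x z y = 0
}.

Definition bullet (prec succ dot : A -> A -> A) (x y : A) : A :=
  prec x y + succ x y + dot x y.

Section PostAlternative.

Variables (gr : 'Z_2 -> {vspace A}).
Variables (prec succ dot : A -> A -> A) (alpha : A -> A).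

Local Notation "x '≺' y" := (prec x y) (at level 40, left associativity).
Local Notation "x '≻' y" := (succ x y) (at level 40, left associativity).
Local Notation "x '⋅' y" := (dot x y) (at level 40, left associativity).
Local Notation "x '•' y" := (bullet prec succ dot x y)
  (at level 40, left associativity).
Local Notation α := alpha.

(* i, j, k are the degrees of x, y, z. *)
Definition post_alternative_identities (i j k : 'Z_2) (x y z : A) : Prop :=
  let sxy := ksign i j in
  let syz := ksign j k in
  [/\ (x ⋅ y) ⋅ α z - α x ⋅ (y ⋅ z)
        + sxy *: ((y ⋅ x) ⋅ α z) - sxy *: (α y ⋅ (x ⋅ z)) = 0,
      (x ⋅ y) ⋅ α z - α x ⋅ (y ⋅ z)
        + syz *: ((x ⋅ z) ⋅ α y) - syz *: (α x ⋅ (z ⋅ y)) = 0,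
      (x ⋅ y) ≺ α z - α x ⋅ (y ≺ z)
        + sxy *: ((y ⋅ x) ≺ α z) - sxy *: (α y ⋅ (x ≺ z)) = 0,
      (x ≻ y) ⋅ α z - α x ≻ (y ⋅ z)
        + syz *: ((x ≻ z) ⋅ α y) - syz *: (α x ≻ (z ⋅ y)) = 0
    & (y ≻ x) ⋅ α z - α y ≻ (x ⋅ z)
        + sxy *: ((x ≺ y) ⋅ α z) - sxy *: (α x ⋅ (y ≻ z)) = 0] /\
  [/\ (z ≺ x) ⋅ α y - α z ⋅ (x ≻ y)
        + sxy *: ((z ⋅ y) ≺ α x) - sxy *: (α z ⋅ (y ≺ x)) = 0,
      (x ≻ y) ≺ α z - α x ≻ (y ≺ z)
        + sxy *: ((y ≺ x) ≺ α z) - sxy *: (α y ≺ (x • z)) = 0,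
      (x ≻ y) ≺ α z - α x ≻ (y ≺ z)
        + syz *: ((x • z) ≻ α y) - syz *: (α x ≻ (z ≻ y)) = 0,
      (x • y) ≻ α z - α x ≻ (y ≻ z)
        + sxy *: ((y • x) ≻ α z) - sxy *: (α y ≻ (x ≻ z)) = 0
    & (z ≺ x) ≺ α y - α z ≺ (x • y)
        + sxy *: ((z ≺ y) ≺ α x) - sxy *: (α z ≺ (y • x)) = 0].

Record is_hom_post_alternative : Prop := {
  hpa_prec : is_hom_superalgebra gr prec alpha;
  hpa_succ : is_hom_superalgebra gr succ alpha;
  hpa_dot : is_hom_superalgebra gr dot alpha;
  hpa_identities : forall (i j k : 'Z_2) (x y z : A),
    x \in gr i -> y \in gr j -> z \in gr k ->
    post_alternative_identities i j k x y z
}.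

End PostAlternative.

End Superalgebra.

(* Main.v *)
(** Write the associator of [•] as a sum of seven mixed associators
    [(x * y) * α z - α x * (y * z)], one for each way of choosing the four
    products as in the identities (1)-(10).  Each identity says that a mixed
    associator changes, up to the Koszul sign, into a mixed associator of the
    transposed arguments; so transposing two neighbouring arguments permutes the
    seven summands of the associator of [•] and multiplies them by minus the
    sign. *)
Require Import Defs.
From mathcomp Require Import all_boot all_order all_algebra.
Import GRing.Theory.
Local Open Scope ring_scope.

Lemma ksignC (K : fieldType) (i j : 'Z_2) : ksign K i j = ksign K j i.
Proof. by rewrite /ksign mulnC. Qed.

Lemma ksignK (K : fieldType) (A : vectType K) (i j : 'Z_2) :
  involutive ( *:%R (ksign K i j) : A -> A).
Proof. by move=> u; rewrite scalerA /ksign -expr2 sqrr_sign scale1r. Qed.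

(** Since the sign squares to 1, an identity linking the mixed associators [a - b] and [c - d] can
    be solved for either of them. Both solutions are needed as rewrite rules. *)
Lemma ksign_swap (K : fieldType) (A : vectType K) (i j : 'Z_2)
    (a b c d : A) :
  a - b + ksign K i j *: c - ksign K i j *: d = 0 ->
  a - b = - (ksign K i j *: (c - d)) /\ c - d = - (ksign K i j *: (a - b)).
Proof.
rewrite -addrA -scalerBr => /eqP; rewrite addr_eq0 => /eqP ->; split=> //.
by rewrite scalerN opprK ksignK.
Qed.

Section Bilinear.

Variables (K : fieldType) (A : vectType K) (mu : A -> A -> A).
Hypothesis bil_mu : bilinear_for *:%R *:%R mu.

Lemma bilinear_addl (w : A) : {morph mu^~ w : u v / u + v}.
Proof. by move=> u v; have := bil_mu.1 w 1 u v; rewrite /= !scale1r. Qed.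

Lemma bilinear_addr (w : A) : {morph mu w : u v / u + v}.
Proof. by move=> u v; have := bil_mu.2 w 1 u v; rewrite /= !scale1r. Qed.

End Bilinear.

Lemma bilinear_bullet (K : fieldType) (A : vectType K)
    (prec succ dot : A -> A -> A) :
  bilinear_for *:%R *:%R prec -> bilinear_for *:%R *:%R succ ->
  bilinear_for *:%R *:%R dot ->
  bilinear_for *:%R *:%R (bullet prec succ dot).
Proof.
move=> [pl pr] [sl sr] [dl dr]; split=> w a u v; rewrite /bullet /=.
  have := (pl w a u v, sl w a u v, dl w a u v) => /= H.
  by rewrite !H !scalerDr (addrACA (a *: prec _ _)) (addrACA (_ + _)).
by rewrite pr sr dr !scalerDr (addrACA (a *: prec _ _)) (addrACA (_ + _)).
Qed.

Lemma bullet_hom_superalgebra (K : fieldType) (A : vectType K)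
    (gr : 'Z_2 -> {vspace A}) (prec succ dot : A -> A -> A) (alpha : A -> A) :
  is_hom_superalgebra gr prec alpha -> is_hom_superalgebra gr succ alpha ->
  is_hom_superalgebra gr dot alpha ->
  is_hom_superalgebra gr (bullet prec succ dot) alpha.
Proof.
move=> [grG pB pE aL aE pM] [_ sB sE _ _ sM] [_ dB dE _ _ dM].
split=> //; first exact: bilinear_bullet.
  by move=> i j x y xi yj; rewrite /bullet !rpredD ?pE ?sE ?dE.
have aD u v : alpha (u + v) = alpha u + alpha v.
  by have := aL 1 u v; rewrite !scale1r.
by move=> x y; rewrite /bullet !aD pM sM dM.
Qed.

Definition mixed_associator (K : fieldType) (A : vectType K) (alpha : A -> A)
    (m1 m2 m3 m4 : A -> A -> A) (x y z : A) : A :=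
  m2 (m1 x y) (alpha z) - m3 (alpha x) (m4 y z).

Section PostAlternative.

Variables (K : fieldType) (A : vectType K) (gr : 'Z_2 -> {vspace A}).
Variables (prec succ dot : A -> A -> A) (alpha : A -> A).
Hypothesis hpa : is_hom_post_alternative gr prec succ dot alpha.

Local Notation bul := (bullet prec succ dot).
Local Notation massoc := (mixed_associator K A alpha).

(** [succ (bul x y) _] and [prec _ (bul y z)] are kept whole, as in the identities; expanding the
    other inner products leaves seven terms for each bracketing, which pair off. *)
Lemma hom_associator_bullet (x y z : A) :
  hom_associator bul alpha x y z =
    massoc dot dot dot dot x y z + massoc dot prec dot prec x y z
    + massoc prec dot dot succ x y z + massoc succ dot succ dot x y z
    + massoc succ prec succ prec x y z + massoc prec prec prec bul x y z
    + massoc bul succ succ succ x y z.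
Proof.
have [[_ pB _ _ _ _] [_ sB _ _ _ _] [_ dB _ _ _ _] _] := hpa.
have pE u v w : prec (bul u v) w
    = prec (prec u v) w + prec (succ u v) w + prec (dot u v) w.
  by rewrite [bul u v]/bullet !(bilinear_addl _ _ _ pB).
have dE u v w : dot (bul u v) w
    = dot (prec u v) w + dot (succ u v) w + dot (dot u v) w.
  by rewrite [bul u v]/bullet !(bilinear_addl _ _ _ dB).
have sE u v w : succ w (bul u v)
    = succ w (prec u v) + succ w (succ u v) + succ w (dot u v).
  by rewrite [bul u v]/bullet !(bilinear_addr _ _ _ sB).
have dE' u v w : dot w (bul u v)
    = dot w (prec u v) + dot w (succ u v) + dot w (dot u v).
  by rewrite [bul u v]/bullet !(bilinear_addr _ _ _ dB).
rewrite /hom_associator [bul (bul x y) _]/bullet [bul _ (bul y z)]/bullet.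
rewrite pE dE sE dE' /mixed_associator !opprD !addrA.
(* Terms 1 to 7 are bracketed on the left, terms 8 to 14 are the negated ones bracketed on the
   right; the permutation puts partners side by side. *)
by rewrite [LHS](ACl (7*14*3*12*5*13*6*11*2*9*1*8*4*10)).
Qed.

(** Up to minus the sign, transposing [x] and [y] exchanges summands 3 and 4 and summands 5 and 6 of
    [hom_associator_bullet], and preserves the other three. *)
Lemma post_alternative_left (i j k : 'Z_2) (x y z : A) :
  x \in gr i -> y \in gr j -> z \in gr k ->
  hom_associator bul alpha x y z
    + ksign K i j *: hom_associator bul alpha y x z = 0.
Proof.
move=> xi yj zk; have id := hpa_identities hpa.
have [[e1 _ e3 _ e5] [_ e7 _ e9 _]] := id _ _ _ _ _ _ xi yj zk.
(* The exchanges link summands of different shapes, so each also needs its identity with [x] and [y]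
   interchanged. *)
have [[_ _ _ _ f5] [_ f7 _ _ _]] := id _ _ _ _ _ _ yj xi zk.
move: e1 e3 e5 e7 e9 f5 f7; rewrite (ksignC _ j i).
move=> /ksign_swap[e1 _] /ksign_swap[e3 _] /ksign_swap[_ e5].
move=> /ksign_swap[e7 _] /ksign_swap[e9 _].
move=> /ksign_swap[f5 _] /ksign_swap[_ f7].
apply/eqP; rewrite addr_eq0 !hom_associator_bullet.
rewrite /mixed_associator.
rewrite e1 e3 e5 e7 e9 f5 f7.
rewrite -!opprD -!scalerDr; apply/eqP; congr (- (_ *: _)).
by rewrite [RHS](ACl (1*2*4*3*6*5*7)).
Qed.

(** Here summands 2 and 3 and summands 5 and 7 are exchanged, while 1, 4 and 6 are preserved. *)
Lemma post_alternative_right (i j k : 'Z_2) (x y z : A) :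
  x \in gr i -> y \in gr j -> z \in gr k ->
  hom_associator bul alpha x y z
    + ksign K j k *: hom_associator bul alpha x z y = 0.
Proof.
move=> xi yj zk; have id := hpa_identities hpa.
have [[_ e2 _ e4 _] [_ _ e8 _ _]] := id _ _ _ _ _ _ xi yj zk.
have [_ [_ _ f8 _ _]] := id _ _ _ _ _ _ xi zk yj.
(* These two identities have their third variable in front and transpose the other two; the cyclic
   instance puts [x] in front and makes the sign [ksign K j k]. *)
have [_ [e6 _ _ _ e10]] := id _ _ _ _ _ _ yj zk xi.
have [_ [f6 _ _ _ _]] := id _ _ _ _ _ _ zk yj xi.
move: e2 e4 e6 e8 e10 f6 f8; rewrite (ksignC _ k j).
move=> /ksign_swap[e2 _] /ksign_swap[e4 _] /ksign_swap[e6 _].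
move=> /ksign_swap[e8 _] /ksign_swap[e10 _].
move=> /ksign_swap[_ f6] /ksign_swap[_ f8].
apply/eqP; rewrite addr_eq0 !hom_associator_bullet.
rewrite /mixed_associator.
rewrite e2 e4 e6 e8 e10 f6 f8.
rewrite -!opprD -!scalerDr; apply/eqP; congr (- (_ *: _)).
by rewrite [RHS](ACl (1*3*2*4*7*6*5)).
Qed.

End PostAlternative.

Theorem theorem4p3 (K : closedFieldType) (charK : [pchar K] =i pred0)
    (A : vectType K) (gr : 'Z_2 -> {vspace A})
    (prec succ dot : A -> A -> A) (alpha : A -> A) :
  is_hom_post_alternative gr prec succ dot alpha ->
  is_hom_alternative gr (bullet prec succ dot) alpha.
Proof.
move=> hpa; split.
- by case: hpa => *; apply: bullet_hom_superalgebra.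
- exact: post_alternative_left.
- exact: post_alternative_right.
Qed.
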